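(* Let $t_0,y_0 \in \mathbb{R}$, $a>0$, $I=[t_0,t_0+a]$, and let $f:I\times \mathbb{R} \to \mathbb{R}$ be continuous. Consider the problem $$(P)\qquad y'=f(t,y) \quad \text{for all } t \in I, \qquad y(t_0)=y_0.$$ If (P) has a strict lower solution $\alpha$ and a strict upper solution $\beta$, then the following results hold: 1. Problem (P) has at least one solution (on $I$). 2. If $\varphi$ solves (P) just in some domain $[t_0,t_0+\varepsilon]$, with $\varepsilon \in (0,a)$, then it can be extended as a solution of (P) to the whole interval $[t_0,t_0+a]$, and then it satisfies $$\alpha(t) < \varphi(t) < \beta(t) \quad \text{for all } t \in (t_0,t_0+a].$$ 3. Problem (P) has the least solution $\varphi_*:I \to \mathbb{R}$ and the greatest solution $\varphi^*:I \to \mathbb{R}$ (that is, solutions on $I$ such that every solution $\varphi: I\to\mathbb{R}$ of (P) satisfies $\varphi_*(t)\le\varphi(t)\le\varphi^*(t)$ for all $t\in I$), which satisfy $$\varphi_*(t)=\sup \{ \gamma(t) : \gamma \text{ strict lower solution of (P)}\} \quad (t \in I)$$ and $$\varphi^*(t)=\inf \{ \gamma(t) : \gamma \text{ strict upper solution of (P)}\} \quad (t \in I).$$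
   Context: A strict lower solution of (P) is a function $\alpha:I \to \mathbb{R}$ which is continuously differentiable in $I$, with $\alpha(t_0)\le y_0$ and $\alpha'(t)<f(t,\alpha(t))$ for all $t \in I$. A strict upper solution of (P) is a function $\beta:I\to\mathbb{R}$ which is continuously differentiable in $I$, with $\beta(t_0)\ge y_0$ and $\beta'(t)>f(t,\beta(t))$ for all $t \in I$. A solution of (P) on an interval $J$, where $J=I$ or $J=[t_0,t_0+\varepsilon]$, is a differentiable function $\varphi:J\to\mathbb{R}$ with $\varphi(t_0)=y_0$ and $\varphi'(t)=f(t,\varphi(t))$ for all $t\in J$. Derivatives at the endpoints of intervals are one-sided. *)

(* Defs.v *)
From Stdlib Require Import Reals.
From Coquelicot Require Import Coquelicot.
Open Scope R_scope.

(* Functions on an interval J are represented by total functions R -> R.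
   Everything below looks only at their values on J: [continuous_on J] uses
   the subspace topology, and [D_in g d J t] says that the difference quotients
   of g at t taken inside J tend to [d t], which makes the derivative one-sided
   at the endpoints of J. *)

Definition Icc (lo hi : R) : R -> Prop := fun t => lo <= t <= hi.

Definition is_C1_deriv_on (J : R -> Prop) (g dg : R -> R) : Prop :=
  (forall t, J t -> D_in g dg J t) /\ continuous_on J dg.

Definition strict_lower_solution (t0 y0 a : R) (f : R -> R -> R)
    (alpha : R -> R) : Prop :=
  exists dalpha : R -> R,
    is_C1_deriv_on (Icc t0 (t0 + a)) alpha dalpha /\
    alpha t0 <= y0 /\
    (forall t, Icc t0 (t0 + a) t -> dalpha t < f t (alpha t)).

Definition strict_upper_solution (t0 y0 a : R) (f : R -> R -> R)
    (beta : R -> R) : Prop :=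
  exists dbeta : R -> R,
    is_C1_deriv_on (Icc t0 (t0 + a)) beta dbeta /\
    beta t0 >= y0 /\
    (forall t, Icc t0 (t0 + a) t -> dbeta t > f t (beta t)).

(* Solution on [t0, t0 + b]. *)
Definition solution (t0 y0 b : R) (f : R -> R -> R) (phi : R -> R) : Prop :=
  phi t0 = y0 /\
  (forall t, Icc t0 (t0 + b) t ->
     D_in phi (fun s => f s (phi s)) (Icc t0 (t0 + b)) t).

Definition least_solution (t0 y0 a : R) (f : R -> R -> R)
    (phi : R -> R) : Prop :=
  solution t0 y0 a f phi /\
  (forall psi, solution t0 y0 a f psi ->
     forall t, Icc t0 (t0 + a) t -> phi t <= psi t).

Definition greatest_solution (t0 y0 a : R) (f : R -> R -> R)
    (phi : R -> R) : Prop :=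
  solution t0 y0 a f phi /\
  (forall psi, solution t0 y0 a f psi ->
     forall t, Icc t0 (t0 + a) t -> psi t <= phi t).

(* Main.v *)
Require Import Defs.
From Stdlib Require Import Reals Lra ClassicalEpsilon FunctionalExtensionality.
From Coquelicot Require Import Coquelicot.
Open Scope R_scope.

(** Truncating [y] to [[alpha t, beta t]] turns [f] into a bounded continuous field [g], and
    strict comparison with [alpha] and [beta] shows that solutions for [g] are solutions for [f].
    The greatest solution for [g] is the pointwise infimum [phi] of the polygons from [(t0, y0)]
    whose slopes exceed [g]. No compactness of function spaces is needed: prolonging a nearly
    optimal polygon by one segment bounds [phi (t + h)] from above, and a line flatter than [g]
    cannot be crossed downwards by a polygon steeper than [g], which bounds it from below;
    the two bounds together give [phi' = g (t, phi)].
    A polygon has finitely many segments, so it also has slopes exceeding [g + e] for small [e];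
    hence the greatest solutions of [y' = g + e], which are strict upper solutions of the original
    problem, decrease to [phi]. The least solution follows by the reflection [y -> -y]. *)

(** * One-sided derivatives and strict comparison *)

(** Multiplying the difference quotient by [x - t] removes both the division and the exclusion of
    [x = t], which leaves estimates fit for linear arithmetic. *)
Lemma D_in_linear_approx (g d : R -> R) (J : R -> Prop) (t : R) :
  D_in g d J t <->
  (forall e, 0 < e -> exists r, 0 < r /\ forall x, J x -> Rabs (x - t) < r ->
     Rabs (g x - g t - d t * (x - t)) <= e * Rabs (x - t)).
Proof.
  assert (quot : forall x, x <> t ->
    Rabs (g x - g t - d t * (x - t)) =
    Rabs ((g x - g t) / (x - t) - d t) * Rabs (x - t)).
  { intros x hx. rewrite <- Rabs_mult. f_equal. field. lra. }
  split.
  - intros H e he. destruct (H e he) as [r [hr Hr]]. exists r. split; [exact hr|].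
    intros x hx hxt. destruct (Req_dec x t) as [->|hne].
    + rewrite !Rminus_diag, Rmult_0_r, Rminus_0_r, Rabs_R0. lra.
    + rewrite quot by exact hne. apply Rmult_le_compat_r; [apply Rabs_pos|].
      apply Rlt_le, Hr. split; [split; auto | exact hxt].
  - intros H e he. destruct (H (e / 2)) as [r [hr Hr]]; [lra|].
    exists r. split; [exact hr|]. intros x [[hx hne] hxt]. simpl in *. unfold Rdist in *.
    specialize (Hr x hx hxt). rewrite quot in Hr by auto.
    apply Rmult_le_reg_r in Hr; [lra|]. apply Rabs_pos_lt. lra.
Qed.

Lemma D_in_continuous (g d : R -> R) (J : R -> Prop) (t e : R) :
  D_in g d J t -> 0 < e ->
  exists r, 0 < r /\ forall x, J x -> Rabs (x - t) < r -> Rabs (g x - g t) < e.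
Proof.
  intros H he. destruct (cont_deriv _ _ _ _ H e he) as [r [hr Hr]].
  exists r. split; [exact hr|]. intros x hx hxt.
  destruct (Req_dec t x) as [<-|hne].
  - rewrite Rminus_diag, Rabs_R0. exact he.
  - apply Hr. split; [split; auto | exact hxt].
Qed.

Lemma D_in_subinterval (g d : R -> R) (p q p' q' t : R) :
  p <= p' -> q' <= q -> D_in g d (Icc p q) t -> D_in g d (Icc p' q') t.
Proof.
  intros hp hq. apply D_in_imp. unfold Icc. intros x hx. lra.
Qed.

Lemma D_in_ext_on (g g' d d' : R -> R) (J : R -> Prop) (t : R) :
  J t -> (forall x, J x -> g x = g' x) -> d t = d' t ->
  D_in g d J t -> D_in g' d' J t.
Proof.
  intros ht hg hd H e he. destruct (H e he) as [r [hr Hr]].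
  exists r. split; [exact hr|]. intros x [[hx hne] hxt].
  rewrite <- !hg, <- hd by auto. apply Hr. split; [split; auto | exact hxt].
Qed.

(** Suppose positivity fails. Then [w] is negative at some [s], because a zero with positive slope
    has negative values just before it. At the last point [tau] before [s] with [w tau >= 0], either
    continuity or the positive slope keeps [w] nonnegative a little longer, which is a
    contradiction. *)
Lemma positive_after_start (p q : R) (w dw : R -> R) :
  (forall t, Icc p q t -> D_in w dw (Icc p q) t) ->
  0 <= w p ->
  (forall t, Icc p q t -> w t = 0 -> 0 < dw t) ->
  forall t, p < t <= q -> 0 < w t.
Proof.
  intros hD hp hz t ht. unfold Icc in *.
  destruct (Rlt_or_le 0 (w t)) as [h|h]; [exact h|exfalso].
  assert (hs : exists s, p < s <= q /\ w s < 0).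
  { destruct (Rle_lt_or_eq_dec _ _ h) as [h'|h']; [exists t; lra|].
    assert (hpos := hz t ltac:(lra) h').
    destruct (proj1 (D_in_linear_approx _ _ _ _) (hD t ltac:(lra)) (dw t / 2))
      as [r [hr Hr]]; [lra|].
    (* This point lies in [(p, t)] and within [r] of [t], so the positive slope at [t] forces
       [w x < 0]. *)
    pose (x := Rmax ((p + t) / 2) (t - r / 2)).
    assert (hx : (p + t) / 2 <= x /\ t - r / 2 <= x /\ x < t).
    { unfold x, Rmax. destruct Rle_dec; lra. }
    exists x. split; [lra|].
    assert (H := Hr x ltac:(lra)). rewrite h' in H.
    rewrite (Rabs_left (x - t)) in H by lra.
    specialize (H ltac:(lra)). apply Rabs_le_between in H.
    assert (0 < dw t * (t - x)) by (apply Rmult_lt_0_compat; lra). lra. }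
  destruct hs as [s [hs hws]].
  pose (E := fun x => p <= x <= s /\ 0 <= w x).
  destruct (completeness E) as [tau [hub hlub]].
  { exists s. intros x hx. apply hx. }
  { exists p. split; [lra|exact hp]. }
  assert (hptau : p <= tau) by (apply hub; split; [lra|exact hp]).
  assert (htaus : tau <= s) by (apply hlub; intros x hx; apply hx).
  assert (hafter : forall x, tau < x <= s -> w x < 0).
  { intros x hx. destruct (Rlt_or_le (w x) 0) as [h0|h0]; [exact h0|].
    assert (x <= tau) by (apply hub; split; [lra|exact h0]). lra. }
  assert (hwtau : 0 <= w tau).
  { destruct (Rlt_or_le (w tau) 0) as [hneg|h0]; [exfalso|exact h0].
    destruct (D_in_continuous _ _ _ tau (- w tau) (hD tau ltac:(lra))) as [r [hr Hr]];
      [lra|].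
    assert (tau <= tau - r); [|lra].
    apply hlub. intros x [hx hwx].
    assert (x <= tau) by (apply hub; split; assumption).
    destruct (Rle_lt_dec x (tau - r)) as [|hlt]; [assumption|exfalso].
    assert (hnear := Hr x ltac:(lra) ltac:(apply Rabs_lt_between; lra)).
    apply Rabs_lt_between in hnear; lra. }
  assert (htaus' : tau < s).
  { destruct htaus as [|heq]; [assumption|]. rewrite heq in hwtau. lra. }
  (* If [w tau > 0], continuity suffices. If [w tau = 0], the linear approximation with error rate
     [dw tau] suffices, since slope minus error is still nonnegative. *)
  assert (hr : exists r, 0 < r /\ forall x, tau < x <= s -> x - tau < r -> 0 <= w x).
  { destruct (Rle_lt_or_eq_dec _ _ hwtau) as [h0|h0].
    - destruct (D_in_continuous _ _ _ tau (w tau) (hD tau ltac:(lra)) h0) as [r [hr Hr]].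
      exists r. split; [exact hr|]. intros x hx hxr.
      assert (hnear := Hr x ltac:(lra) ltac:(apply Rabs_lt_between; lra)).
      apply Rabs_lt_between in hnear; lra.
    - assert (hpos := hz tau ltac:(lra) (eq_sym h0)).
      destruct (proj1 (D_in_linear_approx _ _ _ _) (hD tau ltac:(lra)) (dw tau))
        as [r [hr Hr]]; [lra|].
      exists r. split; [exact hr|]. intros x hx hxr.
      assert (H := Hr x ltac:(lra)). rewrite (Rabs_right (x - tau)) in H by lra.
      specialize (H ltac:(lra)). apply Rabs_le_between in H. lra. }
  destruct hr as [r [hr Hr]].
  pose (x := Rmin s (tau + r / 2)).
  assert (hx : tau < x <= s /\ x - tau < r) by (unfold x, Rmin; destruct Rle_dec; lra).
  assert (h1 := hafter x ltac:(lra)). assert (h2 := Hr x ltac:(lra) ltac:(lra)). lra.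
Qed.

(** Slopes are compared only where the graphs meet. At a contact with [alpha] or [beta] the
    truncated field agrees with [f], so the lemma applies to it as well. *)
Lemma strict_comparison (p q : R) (u v du dv : R -> R) :
  (forall t, Icc p q t -> D_in u du (Icc p q) t) ->
  (forall t, Icc p q t -> D_in v dv (Icc p q) t) ->
  v p <= u p ->
  (forall t, Icc p q t -> u t = v t -> dv t < du t) ->
  forall t, p < t <= q -> v t < u t.
Proof.
  intros hu hv h0 hc t ht. apply Rminus_lt_0.
  apply (positive_after_start p q (fun x => u x - v x) (fun x => du x - dv x)).
  - intros x hx. apply Dminus; auto.
  - lra.
  - intros x hx heq. assert (dv x < du x) by (apply hc; [exact hx|lra]). lra.
  - exact ht.
Qed.

(** * Polygons steeper than the field, and their infimum *)

(** The margin [e] makes [reach] stable under small perturbations of [g]. *)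
Inductive reach (g : R -> R -> R) (t0 y0 : R) : R -> R -> Prop :=
| reach_start : reach g t0 y0 t0 y0
| reach_step t y m h e :
    reach g t0 y0 t y -> 0 <= h -> 0 < e ->
    (forall s, 0 <= s <= h -> g (t + s) (y + m * s) + e <= m) ->
    reach g t0 y0 (t + h) (y + m * h).

(** [real] sends infinite values to 0; [envelope_is_glb] rules these out for bounded [g] and
    [t0 <= t]. *)
Definition envelope (g : R -> R -> R) (t0 y0 t : R) : R :=
  real (Glb_Rbar (reach g t0 y0 t)).

Lemma reach_time (g : R -> R -> R) (t0 y0 t y : R) : reach g t0 y0 t y -> t0 <= t.
Proof. intros H. induction H; lra. Qed.

(** A crossing needs [m < k], but at the meeting time [(u - v) / (k - m)] both slopes are compared
    with the same value of [g], which gives [k < m]. *)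
Lemma lines_do_not_cross (g : R -> R -> R) (t u v m k h : R) :
  0 <= h -> v <= u ->
  (forall s, 0 <= s <= h -> g (t + s) (u + m * s) < m) ->
  (forall s, 0 <= s <= h -> k < g (t + s) (v + k * s)) ->
  v + k * h <= u + m * h.
Proof.
  intros hh hvu hm hk.
  destruct (Rle_or_lt (v + k * h) (u + m * h)) as [|hlt]; [assumption|exfalso].
  assert (hmk : m < k).
  { destruct (Rlt_or_le m k) as [|h']; [assumption|].
    assert (k * h <= m * h) by (apply Rmult_le_compat_r; lra). lra. }
  pose (s := (u - v) / (k - m)).
  assert (hs : 0 <= s <= h).
  { unfold s. split.
    - apply Rdiv_le_0_compat; lra.
    - apply Rle_div_l; lra. }
  assert (heq : u + m * s = v + k * s) by (unfold s; field; lra).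
  assert (h1 := hm s hs). assert (h2 := hk s hs). rewrite heq in h1. lra.
Qed.

(** Induction along the polygon: each segment after [t1] is compared with the line by
    [lines_do_not_cross]. *)
Lemma reach_above_line (g : R -> R -> R) (t0 y0 t1 z k : R) :
  t0 <= t1 ->
  (forall y, reach g t0 y0 t1 y -> z <= y) ->
  forall t y, reach g t0 y0 t y -> t1 <= t ->
  (forall s, 0 <= s <= t - t1 -> k < g (t1 + s) (z + k * s)) ->
  z + k * (t - t1) <= y.
Proof.
  intros ht1 hz t y H. induction H as [|t y m h e H IH hh he hm]; intros ht hk.
  - assert (t1 = t0) as -> by lra. rewrite Rminus_diag, Rmult_0_r, Rplus_0_r.
    apply hz. constructor.
  - destruct (Rle_or_lt t1 t) as [htt|htt].
    + assert (hIH := IH htt ltac:(intros s hs; apply hk; lra)).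
      assert (C := lines_do_not_cross g t y (z + k * (t - t1)) m k h hh hIH).
      replace (z + k * (t + h - t1)) with (z + k * (t - t1) + k * h) by ring.
      apply C.
      * intros s hs. specialize (hm s hs). lra.
      * intros s hs. replace (t + s) with (t1 + (t - t1 + s)) by ring.
        replace (z + k * (t - t1) + k * s) with (z + k * (t - t1 + s)) by ring.
        apply hk. lra.
    (* The segment straddles [t1]. Cutting it there gives a polygon ending at time [t1], to which
       [hz] applies; only the remaining piece is compared with the line. *)
    + assert (hR : reach g t0 y0 t1 (y + m * (t1 - t))).
      { replace t1 with (t + (t1 - t)) at 1 by ring.
        apply reach_step with e; [exact H|lra|exact he|]. intros s hs. apply hm. lra. }
      assert (C := lines_do_not_cross g t1 (y + m * (t1 - t)) z m k (t + h - t1)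
                     ltac:(lra) (hz _ hR)).
      replace (y + m * h) with (y + m * (t1 - t) + m * (t + h - t1)) by ring.
      apply C; [|exact hk].
      intros s hs. replace (t1 + s) with (t + (t1 - t + s)) by ring.
      replace (y + m * (t1 - t) + m * s) with (y + m * (t1 - t + s)) by ring.
      assert (hms := hm (t1 - t + s) ltac:(lra)). lra.
Qed.

(** Half of each segment's margin absorbs the perturbation and the other half remains as margin;
    finitely many segments leave a positive [e0]. *)
Lemma reach_perturb (g : R -> R -> R) (t0 y0 t y : R) :
  reach g t0 y0 t y ->
  exists e0, 0 < e0 /\
    forall e, 0 < e <= e0 -> reach (fun t y => g t y + e) t0 y0 t y.
Proof.
  intros H. induction H as [|t y m h e H [e0 [he0 IH]] hh he hm].
  - exists 1. split; [lra|]. constructor.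
  - exists (Rmin e0 (e / 2)). split; [apply Rmin_pos; lra|]. intros e' he'.
    assert (Rmin e0 (e / 2) <= e0 /\ Rmin e0 (e / 2) <= e / 2)
      by (split; [apply Rmin_l|apply Rmin_r]).
    apply reach_step with (e / 2); [apply IH; lra|exact hh|lra|].
    intros s hs. specialize (hm s hs). lra.
Qed.

(** The segments are strictly steeper than [g], so strict comparison works on each of them although
    [v] is only a weak subsolution. This is the source of maximality of the envelope. *)
Lemma reach_above_subsolution (g : R -> R -> R) (t0 y0 q : R) (v dv : R -> R) :
  (forall t, Icc t0 q t -> D_in v dv (Icc t0 q) t) ->
  (forall t, Icc t0 q t -> dv t <= g t (v t)) ->
  v t0 <= y0 ->
  forall t y, reach g t0 y0 t y -> t <= q -> v t <= y.
Proof.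
  intros hD hv h0 t y H. induction H as [|t y m h e H IH hh he hm]; intros ht; [exact h0|].
  assert (hvy := IH ltac:(lra)). assert (ht0 := reach_time _ _ _ _ _ H).
  (* Zero-length segments are treated apart, since strict comparison concludes only after the
     initial time. *)
  destruct hh as [hh|<-]; [|rewrite Rmult_0_r, !Rplus_0_r; exact hvy].
  apply Rlt_le.
  replace (y + m * h) with (y + m * (t + h - t)) by ring.
  apply (strict_comparison t (t + h) (fun x => y + m * (x - t)) v (fun _ => m) dv).
  - intros x hx. apply D_in_linear_approx. intros e' he'. exists 1. split; [lra|].
    intros x' _ _. replace (_ - _ - _) with 0 by ring. rewrite Rabs_R0.
    apply Rmult_le_pos; [lra|apply Rabs_pos].
  - intros x hx. apply D_in_subinterval with t0 q; [lra|lra|].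
    unfold Icc in *. apply hD. lra.
  - rewrite Rminus_diag. lra.
  - unfold Icc in *. intros x hx heq. assert (hdx := hv x ltac:(lra)). rewrite <- heq in hdx.
    assert (hmx := hm (x - t) ltac:(lra)). replace (t + (x - t)) with x in hmx by ring. lra.
  - lra.
Qed.

(** * The infimum of steep polygons solves the equation of a bounded field *)

Section Envelope.

Variables (g : R -> R -> R) (t0 y0 M : R).
Hypothesis hM : forall t y, Rabs (g t y) <= M.

Let phi := envelope g t0 y0.

Lemma reach_lower_bound (t y : R) : reach g t0 y0 t y -> y0 - (M + 1) * (t - t0) <= y.
Proof.
  intros H. replace (y0 - _) with (y0 + (- (M + 1)) * (t - t0)) by ring.
  assert (ht := reach_time _ _ _ _ _ H).
  apply reach_above_line with g t0 y0; try exact H; try lra.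
  (* At time [t0] the bound comes from a constant on the one-point interval, where differentiability
     is vacuous. *)
  - intros y' H'. apply (reach_above_subsolution g t0 y0 t0 (fun _ => y0) (fun x => g x y0))
      with t0; try exact H'; try lra.
    + intros x hx. unfold Icc in hx. intros e he. exists 1. split; [lra|].
      intros x' [[hx' hne] _]. unfold Icc in hx'. lra.
    + intros x hx. lra.
  - intros s hs. assert (hb := proj1 (Rabs_le_between _ _) (hM (t0 + s) (y0 + - (M + 1) * s))).
    lra.
Qed.

Lemma reach_nonempty (t : R) : t0 <= t -> exists y, reach g t0 y0 t y.
Proof.
  intros ht. exists (y0 + (M + 1) * (t - t0)).
  replace t with (t0 + (t - t0)) at 1 by ring.
  apply reach_step with 1; [constructor|lra|lra|]. intros s hs.
  assert (hb := proj1 (Rabs_le_between _ _) (hM (t0 + s) (y0 + (M + 1) * s))). lra.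
Qed.

Lemma envelope_is_glb (t : R) : t0 <= t -> is_glb_Rbar (reach g t0 y0 t) (phi t).
Proof.
  intros ht. assert (H := Glb_Rbar_correct (reach g t0 y0 t)).
  unfold phi, envelope. destruct (reach_nonempty t ht) as [y hy].
  destruct (Glb_Rbar (reach g t0 y0 t)) as [l| |]; [exact H| |].
  - elim (proj1 H y hy).
  - elim (proj2 H (Finite (y0 - (M + 1) * (t - t0)))). intros z hz.
    apply reach_lower_bound, hz.
Qed.

Lemma envelope_le (t y : R) : reach g t0 y0 t y -> phi t <= y.
Proof.
  intros H. apply (proj1 (envelope_is_glb t (reach_time _ _ _ _ _ H)) y H).
Qed.

Lemma envelope_ge (t z : R) :
  t0 <= t -> (forall y, reach g t0 y0 t y -> z <= y) -> z <= phi t.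
Proof.
  intros ht hz. apply (proj2 (envelope_is_glb t ht) (Finite z) hz).
Qed.

Lemma envelope_approx (t e : R) :
  t0 <= t -> 0 < e -> exists y, reach g t0 y0 t y /\ y < phi t + e.
Proof.
  intros ht he. apply NNPP. intros hn.
  assert (phi t + e <= phi t); [|lra].
  apply envelope_ge; [exact ht|]. intros y hy.
  destruct (Rle_or_lt (phi t + e) y) as [|hlt]; [assumption|]. elim hn. eauto.
Qed.

Lemma envelope_start : phi t0 = y0.
Proof.
  apply Rle_antisym; [apply envelope_le; constructor|].
  apply envelope_ge; [lra|]. intros y hy. apply reach_lower_bound in hy.
  rewrite Rminus_diag, Rmult_0_r in hy. lra.
Qed.

(** Below, a line of slope [k1] is flatter than [g] and starts under every polygon at time [t].
    Above, a nearly optimal polygon is prolonged by a segment of slope [k2] with margin [e]. Bounds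
    on [g] are required only in a box of height [r], which neither line leaves. *)
Lemma envelope_step (t h k1 k2 r e : R) :
  t0 <= t -> 0 <= h -> 0 < e ->
  Rabs k1 * h < r -> Rabs k2 * h < r ->
  (forall s y, 0 <= s <= h -> Rabs (y - phi t) < r -> k1 + e <= g (t + s) y <= k2 - e) ->
  phi t + k1 * h <= phi (t + h) <= phi t + k2 * h.
Proof.
  intros ht hh he hk1 hk2 hg.
  assert (hsmall : forall k s, Rabs k * h < r -> 0 <= s <= h -> Rabs (k * s) < r).
  { intros k s hk hs. rewrite Rabs_mult, (Rabs_pos_eq s) by lra.
    apply Rle_lt_trans with (2 := hk). apply Rmult_le_compat_l; [apply Rabs_pos|lra]. }
  split.
  - apply envelope_ge; [lra|]. intros y hy.
    replace (k1 * h) with (k1 * (t + h - t)) by ring.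
    apply reach_above_line with g t0 y0; try exact hy; try lra.
    + intros y' hy'. apply envelope_le, hy'.
    + intros s hs. assert (hk := hsmall k1 s hk1 ltac:(lra)).
      assert (hgs := hg s (phi t + k1 * s)). replace (_ + _ - phi t) with (k1 * s) in hgs by ring.
      specialize (hgs ltac:(lra) hk). lra.
  - apply le_epsilon. intros e' he'.
    (* The second bound leaves room for the prolonging segment to stay within [r] of [phi t]. *)
    destruct (envelope_approx t (Rmin e' (r - Rabs k2 * h)) ht) as [y [hy hyp]];
      [apply Rmin_pos; lra|].
    assert (hyp1 := Rlt_le_trans _ _ _ hyp (Rplus_le_compat_l _ _ _ (Rmin_l _ _))).
    assert (hyp2 := Rlt_le_trans _ _ _ hyp (Rplus_le_compat_l _ _ _ (Rmin_r _ _))).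
    assert (hphi := envelope_le _ _ hy).
    assert (phi (t + h) <= y + k2 * h); [|lra].
    apply envelope_le, reach_step with e; [exact hy|exact hh|exact he|].
    intros s hs.
    assert (hks : Rabs (k2 * s) <= Rabs k2 * h).
    { rewrite Rabs_mult, (Rabs_pos_eq s) by lra.
      apply Rmult_le_compat_l; [apply Rabs_pos|lra]. }
    assert (hgs := hg s (y + k2 * s) hs).
    apply Rabs_le_between in hks.
    assert (Rabs (y + k2 * s - phi t) < r) by (apply Rabs_lt_between; lra).
    specialize (hgs ltac:(assumption)). lra.
Qed.

Lemma envelope_lipschitz (t h : R) :
  t0 <= t -> 0 <= h -> Rabs (phi (t + h) - phi t) <= (M + 1) * h.
Proof.
  intros ht hh.
  assert (hM0 := Rle_trans _ _ _ (Rabs_pos (g t0 y0)) (hM t0 y0)).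
  assert (H := envelope_step t h (- (M + 1)) (M + 1) ((M + 1) * h + 1) 1 ht hh ltac:(lra)).
  rewrite Rabs_Ropp, (Rabs_pos_eq (M + 1)) in H by lra.
  assert (phi t + - (M + 1) * h <= phi (t + h) <= phi t + (M + 1) * h).
  { apply H; try lra. intros s y _ _.
    assert (hb := proj1 (Rabs_le_between _ _) (hM (t + s) y)). lra. }
  apply Rabs_le_between. lra.
Qed.

(** Near [(t, phi t)] the field is within [e / 2] of [g t (phi t)], so [envelope_step] with slopes
    [g t (phi t) - e] and [g t (phi t) + e] gives the linear approximation. *)
Lemma envelope_derivative (t : R) (J : R -> Prop) :
  (forall x, J x -> t0 <= x) -> J t -> continuity_2d_pt g t (phi t) ->
  D_in phi (fun x => g x (phi x)) J t.
Proof.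
  intros hJ ht hg. apply D_in_linear_approx. intros e he.
  destruct (hg (mkposreal (e / 2) ltac:(lra))) as [[r hr] Hr]. simpl in Hr.
  assert (hM0 := Rle_trans _ _ _ (Rabs_pos (g t0 y0)) (hM t0 y0)).
  pose (K := M + 1 + e). assert (hK : 1 <= K) by (unfold K; lra).
  (* [K] bounds both slopes, so along a step shorter than [d] the lines move less than [r / 4]. *)
  pose (d := r / (4 * K)).
  assert (hd : 0 < d) by (apply Rdiv_lt_0_compat; lra).
  assert (hKd : K * d = r / 4) by (unfold d; field; lra).
  assert (hdr : d <= r / 4) by (rewrite <- hKd; nra).
  (* Steps go only forward in time. The base [t1 = t] serves points after [t]; for [x < t] the step
     runs from [t1 = x] to [t], and the Lipschitz bound puts [phi x] within [r / 4] of [phi t]. *)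
  assert (hforward : forall t1 h, t0 <= t1 -> 0 <= h < d -> t - d < t1 -> t1 + h < t + d ->
    Rabs (phi t1 - phi t) <= r / 4 ->
    Rabs (phi (t1 + h) - phi t1 - g t (phi t) * h) <= e * h).
  { intros t1 h ht1 hh h1 h2 hphi.
    assert (hKh : K * h < r / 2) by (apply Rle_lt_trans with (K * d); nra).
    assert (hb := proj1 (Rabs_le_between _ _) (hM t (phi t))).
    assert (H := envelope_step t1 h (g t (phi t) - e) (g t (phi t) + e) (r / 2) (e / 2)
                   ht1 ltac:(lra) ltac:(lra)).
    assert (phi t1 + (g t (phi t) - e) * h <= phi (t1 + h) <= phi t1 + (g t (phi t) + e) * h).
    { apply H.
      - apply Rle_lt_trans with (2 := hKh). apply Rmult_le_compat_r; [lra|].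
        apply Rabs_le_between. unfold K. lra.
      - apply Rle_lt_trans with (2 := hKh). apply Rmult_le_compat_r; [lra|].
        apply Rabs_le_between. unfold K. lra.
      - intros s y hs hy. apply Rabs_le_between in hphi. apply Rabs_lt_between in hy.
        assert (hgs := Hr (t1 + s) y). rewrite !Rabs_lt_between in hgs.
        specialize (hgs ltac:(lra) ltac:(lra)). lra. }
    apply Rabs_le_between. lra. }
  exists d. split; [exact hd|]. intros x hx hxt. apply Rabs_lt_between in hxt.
  assert (h0t := hJ t ht). assert (h0x := hJ x hx).
  destruct (Rle_or_lt t x) as [hle|hlt].
  - rewrite (Rabs_pos_eq (x - t)) by lra.
    assert (H := hforward t (x - t)). replace (t + (x - t)) with x in H by ring.
    apply H; try lra. rewrite Rminus_diag, Rabs_R0. lra.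
  - rewrite (Rabs_left (x - t)) by lra.
    assert (H := hforward x (t - x)). replace (x + (t - x)) with t in H by ring.
    assert (L := envelope_lipschitz x (t - x) h0x ltac:(lra)).
    replace (x + (t - x)) with t in L by ring.
    replace (phi x - phi t - g t (phi t) * (x - t))
      with (- (phi t - phi x - g t (phi t) * (t - x))) by ring.
    rewrite Rabs_Ropp, Ropp_minus_distr. apply H; try lra.
    rewrite Rabs_minus_sym. apply Rle_trans with (1 := L).
    unfold K in *. nra.
Qed.

End Envelope.

(** A nearly optimal polygon for [g] stays admissible for [g + e] by [reach_perturb]. *)
Lemma envelope_perturb (g : R -> R -> R) (t0 y0 M t eta : R) :
  (forall t y, Rabs (g t y) <= M) -> t0 <= t -> 0 < eta ->
  exists e0, 0 < e0 /\ forall e, 0 < e <= e0 ->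
    envelope (fun t y => g t y + e) t0 y0 t < envelope g t0 y0 t + eta.
Proof.
  intros hM ht heta.
  destruct (envelope_approx g t0 y0 M hM t eta ht heta) as [y [hy hlt]].
  destruct (reach_perturb _ _ _ _ _ hy) as [e0 [he0 H]].
  exists e0. split; [exact he0|]. intros e he.
  apply Rle_lt_trans with (2 := hlt).
  apply (envelope_le _ t0 y0 (M + e)); [|apply H, he].
  intros t' y'. apply Rle_trans with (1 := Rabs_triang _ _).
  rewrite (Rabs_pos_eq e) by lra. apply Rplus_le_compat_r, hM.
Qed.

(** * Truncation between a lower and an upper solution *)

Definition clamp (lo hi x : R) : R := Rmax lo (Rmin x hi).

Lemma clamp_in (lo hi x : R) : lo <= hi -> Icc lo hi (clamp lo hi x).
Proof. intros h. unfold Icc, clamp, Rmax, Rmin. repeat destruct Rle_dec; lra. Qed.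

Lemma clamp_id (lo hi x : R) : Icc lo hi x -> clamp lo hi x = x.
Proof. unfold Icc, clamp, Rmax, Rmin. intros h. repeat destruct Rle_dec; lra. Qed.

Lemma clamp_close (lo hi x lo' hi' x' d : R) :
  Rabs (lo' - lo) < d -> Rabs (hi' - hi) < d -> Rabs (x' - x) < d ->
  Rabs (clamp lo' hi' x' - clamp lo hi x) < d.
Proof.
  intros h1 h2 h3. apply Rabs_lt_between in h1, h2, h3. apply Rabs_lt_between.
  unfold clamp, Rmax, Rmin. repeat destruct Rle_dec; lra.
Qed.

(** Clamping the argument extends [u] by constants, so that results about functions continuous on
    the whole line apply. *)
Lemma continuous_on_clamp (lo hi : R) (u : R -> R) :
  lo <= hi -> continuous_on (Icc lo hi) u ->
  forall t, continuity_pt (fun x => u (clamp lo hi x)) t.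
Proof.
  intros hlh hu t. apply continuity_pt_locally. intros e.
  destruct (proj1 (filterlim_locally _ _) (hu (clamp lo hi t) (clamp_in _ _ _ hlh)) e)
    as [d Hd].
  exists d. intros x hx. apply Hd; [|apply clamp_in, hlh].
  apply clamp_close; [rewrite Rminus_diag, Rabs_R0; apply cond_pos..|exact hx].
Qed.

Lemma D_in_continuous_on (g d : R -> R) (J : R -> Prop) :
  (forall t, J t -> D_in g d J t) -> continuous_on J g.
Proof.
  intros H t ht. apply filterlim_locally. intros [e he].
  destruct (D_in_continuous g d J t e (H t ht) he) as [r [hr Hr]].
  exists (mkposreal r hr). intros x hx hJ. apply Hr; [exact hJ|exact hx].
Qed.

Lemma continuity_pt_continuous_on (D : R -> Prop) (u : R -> R) :
  (forall t, D t -> continuity_pt u t) -> continuous_on D u.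
Proof.
  intros H t ht. apply filterlim_locally. intros e.
  destruct (proj1 (continuity_pt_locally u t) (H t ht) e) as [d Hd].
  exists d. intros x hx _. apply Hd, hx.
Qed.

Lemma continuity_pt_graph (g : R -> R -> R) (u : R -> R) (t : R) :
  continuity_2d_pt g t (u t) -> continuity_pt u t ->
  continuity_pt (fun x => g x (u x)) t.
Proof.
  intros hg hu. apply continuity_pt_locally. intros e.
  destruct (hg e) as [d Hd].
  destruct (proj1 (continuity_pt_locally u t) hu d) as [d' Hd'].
  exists (mkposreal (Rmin d d') (Rmin_pos _ _ (cond_pos d) (cond_pos d'))).
  intros x hx. change (Rabs (x - t) < Rmin d d') in hx.
  apply Hd; [|apply Hd'; change (Rabs (x - t) < d')];
    apply Rlt_le_trans with (1 := hx); [apply Rmin_l|apply Rmin_r].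
Qed.

(** The gauge at a point is at most [/ (Rabs (g t y) + 1)] and small enough for [g] to vary by less
    than 1. Compactness gives a [d] such that every point is close to one whose gauge is at least
    [d], and [/ d] is then a bound. *)
Lemma continuity_2d_bounded (g : R -> R -> R) (p q p' q' : R) :
  (forall t y, continuity_2d_pt g t y) ->
  exists M, forall t y, Icc p q t -> Icc p' q' y -> Rabs (g t y) <= M.
Proof.
  intros hg.
  assert (hpos : forall t y, 0 < / (Rabs (g t y) + 1)).
  { intros t y. apply Rinv_0_lt_compat. assert (H := Rabs_pos (g t y)). lra. }
  assert (hd : forall t y, {d : posreal | d <= / (Rabs (g t y) + 1) /\
    forall x z, Rabs (x - t) < d -> Rabs (z - y) < d -> Rabs (g x z - g t y) < 1}).
  { intros t y. apply constructive_indefinite_description.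
    destruct (hg t y (mkposreal 1 Rlt_0_1)) as [d Hd].
    exists (mkposreal _ (Rmin_pos _ _ (cond_pos d) (hpos t y))). simpl. split; [apply Rmin_r|].
    intros x z hx hz. apply Hd; eapply Rlt_le_trans; try eassumption; apply Rmin_l. }
  destruct (compactness_value_2d p q p' q' (fun t y => proj1_sig (hd t y))) as [[d hd0] Hd].
  exists (/ d). intros t y ht hy. apply Rnot_lt_le. intros hlt.
  apply (Hd t y ht hy). intros [u [v [_ [_ [hu [hv huv]]]]]].
  destruct (hd u v) as [[d' hd'] [h1 h2]]. simpl in *.
  assert (hgt := h2 t y hu hv).
  assert (hinv : Rabs (g u v) + 1 <= / d).
  { rewrite <- (Rinv_inv (Rabs (g u v) + 1)). apply Rinv_le_contravar; [exact hd0|lra]. }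
  assert (htri := Rabs_triang_inv (g t y) (g u v)). lra.
Qed.

(** Time is clamped too, so the field is continuous and bounded on the whole plane while [f] is
    evaluated only over the interval. *)
Definition truncate (t0 a : R) (alpha beta : R -> R) (f : R -> R -> R) (t y : R) : R :=
  let t' := clamp t0 (t0 + a) t in f t' (clamp (alpha t') (beta t') y).

Lemma truncate_inside (t0 a : R) (alpha beta : R -> R) (f : R -> R -> R) (t y : R) :
  Icc t0 (t0 + a) t -> alpha t <= y <= beta t ->
  truncate t0 a alpha beta f t y = f t y.
Proof.
  intros ht hy. unfold truncate. cbv zeta. rewrite (clamp_id _ _ t ht).
  rewrite clamp_id; [reflexivity|exact hy].
Qed.

Section Truncation.

Variables (t0 a : R) (alpha beta : R -> R) (f : R -> R -> R).
Hypothesis ha : 0 < a.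
Hypothesis hf : continuous_on (fun p : R * R => Icc t0 (t0 + a) (fst p))
  (fun p : R * R => f (fst p) (snd p)).
Hypothesis halpha : continuous_on (Icc t0 (t0 + a)) alpha.
Hypothesis hbeta : continuous_on (Icc t0 (t0 + a)) beta.

Let c := clamp t0 (t0 + a).
Let g := truncate t0 a alpha beta f.

Lemma truncate_continuous (t y : R) : continuity_2d_pt g t y.
Proof.
  intros e. assert (hi : t0 <= t0 + a) by lra.
  destruct (proj1 (filterlim_locally _ _)
    (hf (c t, clamp (alpha (c t)) (beta (c t)) y) (clamp_in _ _ _ hi)) e) as [d Hd].
  destruct (proj1 (continuity_pt_locally _ _) (continuous_on_clamp _ _ _ hi halpha t) d)
    as [d1 Hd1].
  destruct (proj1 (continuity_pt_locally _ _) (continuous_on_clamp _ _ _ hi hbeta t) d)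
    as [d2 Hd2].
  exists (mkposreal (Rmin d (Rmin d1 d2))
            (Rmin_pos _ _ (cond_pos d) (Rmin_pos _ _ (cond_pos d1) (cond_pos d2)))).
  simpl. intros t' y' ht' hy'.
  assert (hm1 := Rmin_l d (Rmin d1 d2)). assert (hm2 := Rmin_r d (Rmin d1 d2)).
  assert (hm3 := Rmin_l d1 d2). assert (hm4 := Rmin_r d1 d2).
  apply (Hd (c t', clamp (alpha (c t')) (beta (c t')) y')); [|apply clamp_in, hi].
  split; simpl.
  - apply clamp_close; [rewrite Rminus_diag, Rabs_R0; apply cond_pos..|lra].
  - apply clamp_close; [apply Hd1|apply Hd2|lra].
    + change (Rabs (t' - t) < d1). lra.
    + change (Rabs (t' - t) < d2). lra.
Qed.

Lemma truncate_bounded : exists M, forall t y, Rabs (g t y) <= M.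
Proof.
  assert (hi : t0 <= t0 + a) by lra.
  destruct (continuity_ab_min _ t0 (t0 + a) hi
    (fun x _ => continuous_on_clamp _ _ _ hi halpha x)) as [mA [hA _]].
  destruct (continuity_ab_maj _ t0 (t0 + a) hi
    (fun x _ => continuous_on_clamp _ _ _ hi halpha x)) as [mA' [hA' _]].
  destruct (continuity_ab_maj _ t0 (t0 + a) hi
    (fun x _ => continuous_on_clamp _ _ _ hi hbeta x)) as [mB [hB _]].
  destruct (continuity_2d_bounded g t0 (t0 + a) (alpha (clamp t0 (t0 + a) mA))
    (Rmax (alpha (clamp t0 (t0 + a) mA')) (beta (clamp t0 (t0 + a) mB))) truncate_continuous)
    as [M HM].
  exists M. intros t y.
  pose (y' := clamp (alpha (c t)) (beta (c t)) y).
  assert (hct : Icc t0 (t0 + a) (c t)) by (apply clamp_in, hi).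
  (* Clamping is idempotent, so every value of [g] is already taken on the compact box just
     chosen. *)
  assert (heq : g t y = g (c t) y').
  { unfold g, truncate. cbv zeta. fold c. replace (c (c t)) with (c t) by (symmetry; apply clamp_id, hct).
    f_equal. unfold y', clamp, Rmax, Rmin. repeat destruct Rle_dec; lra. }
  rewrite heq. apply HM; [exact hct|].
  specialize (hA _ hct). specialize (hA' _ hct). specialize (hB _ hct). cbv beta in *.
  fold c in hA, hA', hB |- *.
  replace (c (c t)) with (c t) in * by (symmetry; apply clamp_id, hct).
  unfold y', Icc, clamp, Rmax, Rmin. repeat destruct Rle_dec; lra.
Qed.

End Truncation.

(** * Comparison of solutions with strict lower and upper solutions *)

Lemma strict_lower_lt_solution (t0 y0 a b : R) (f : R -> R -> R) (alpha phi : R -> R) :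
  strict_lower_solution t0 y0 a f alpha -> b <= a -> solution t0 y0 b f phi ->
  forall t, t0 < t <= t0 + b -> alpha t < phi t.
Proof.
  intros [dalpha [[hD _] [h0 hlt]]] hba [hphi0 hphi].
  apply (strict_comparison t0 (t0 + b) phi alpha (fun s => f s (phi s)) dalpha).
  - exact hphi.
  - intros t ht. apply D_in_subinterval with t0 (t0 + a); [lra|lra|].
    unfold Icc in *. apply hD. lra.
  - lra.
  - unfold Icc in *. intros t ht ->. apply hlt. lra.
Qed.

Lemma solution_lt_strict_upper (t0 y0 a b : R) (f : R -> R -> R) (beta phi : R -> R) :
  strict_upper_solution t0 y0 a f beta -> b <= a -> solution t0 y0 b f phi ->
  forall t, t0 < t <= t0 + b -> phi t < beta t.
Proof.
  intros [dbeta [[hD _] [h0 hlt]]] hba [hphi0 hphi].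
  apply (strict_comparison t0 (t0 + b) beta phi dbeta (fun s => f s (phi s))).
  - intros t ht. apply D_in_subinterval with t0 (t0 + a); [lra|lra|].
    unfold Icc in *. apply hD. lra.
  - exact hphi.
  - lra.
  - unfold Icc in *. intros t ht <-. apply hlt. lra.
Qed.

Lemma solution_between (t0 y0 a : R) (f : R -> R -> R) (alpha beta phi : R -> R) :
  strict_lower_solution t0 y0 a f alpha -> strict_upper_solution t0 y0 a f beta ->
  solution t0 y0 a f phi ->
  forall t, Icc t0 (t0 + a) t -> alpha t <= phi t <= beta t.
Proof.
  intros hl hu hs t ht. unfold Icc in ht.
  destruct (Rle_lt_or_eq_dec _ _ (proj1 ht)) as [h|<-].
  - assert (h1 := strict_lower_lt_solution _ _ _ _ _ _ _ hl (Rle_refl a) hs t).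
    assert (h2 := solution_lt_strict_upper _ _ _ _ _ _ _ hu (Rle_refl a) hs t). lra.
  - destruct hl as [_ [_ [hl _]]], hu as [_ [_ [hu _]]], hs as [hs _]. lra.
Qed.

Lemma strict_lower_le_strict_upper (t0 y0 a : R) (f : R -> R -> R) (alpha beta : R -> R) :
  strict_lower_solution t0 y0 a f alpha -> strict_upper_solution t0 y0 a f beta ->
  forall t, Icc t0 (t0 + a) t -> alpha t <= beta t.
Proof.
  intros [dalpha [[hDa _] [h0a hlta]]] [dbeta [[hDb _] [h0b hltb]]] t [ht ht'].
  destruct ht as [ht|<-]; [|lra].
  apply Rlt_le, (strict_comparison t0 (t0 + a) beta alpha dbeta dalpha); try assumption; try lra.
  intros x hx heq. specialize (hlta x hx). specialize (hltb x hx). rewrite heq in hltb. lra.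
Qed.

(** * The greatest solution and its approximation from above *)

Lemma greatest_solution_exists (t0 y0 a : R) (f : R -> R -> R) (alpha beta : R -> R) :
  0 < a ->
  continuous_on (fun p : R * R => Icc t0 (t0 + a) (fst p))
    (fun p : R * R => f (fst p) (snd p)) ->
  strict_lower_solution t0 y0 a f alpha ->
  strict_upper_solution t0 y0 a f beta ->
  exists phi, greatest_solution t0 y0 a f phi /\
    forall t eta, Icc t0 (t0 + a) t -> 0 < eta ->
      exists gamma, strict_upper_solution t0 y0 a f gamma /\ gamma t < phi t + eta.
Proof.
  intros ha hf hl hu.
  assert (hab := strict_lower_le_strict_upper _ _ _ _ _ _ hl hu).
  assert (hbetween := solution_between t0 y0 a f alpha beta).
  assert (hl' := hl). destruct hl' as [dalpha [[hDa hCa] [h0a hlta]]].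
  assert (hu' := hu). destruct hu' as [dbeta [[hDb hCb] [h0b hltb]]].
  assert (hi : t0 <= t0 + a) by lra.
  assert (hca := D_in_continuous_on _ _ _ hDa).
  assert (hcb := D_in_continuous_on _ _ _ hDb).
  pose (g := truncate t0 a alpha beta f).
  assert (hin : forall t y, Icc t0 (t0 + a) t -> alpha t <= y <= beta t -> g t y = f t y)
    by (apply truncate_inside).
  assert (hg : forall t y, continuity_2d_pt g t y) by (apply truncate_continuous; assumption).
  destruct (truncate_bounded t0 a alpha beta f ha hf hca hcb) as [M hM]. fold g in hM.
  pose (phi e := envelope (fun t y => g t y + e) t0 y0).
  assert (hMe : forall e t y, Rabs (g t y + e) <= M + Rabs e).
  { intros e t y. apply Rle_trans with (1 := Rabs_triang _ _), Rplus_le_compat_r, hM. }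
  assert (hphi0 : forall e, phi e t0 = y0).
  { intros e. apply envelope_start with (M + Rabs e), hMe. }
  assert (hphi : forall e t, Icc t0 (t0 + a) t ->
    D_in (phi e) (fun x => g x (phi e x) + e) (Icc t0 (t0 + a)) t).
  { intros e t ht. apply (envelope_derivative (fun t y => g t y + e) t0 y0 (M + Rabs e) (hMe e)).
    - unfold Icc. intros x hx. lra.
    - exact ht.
    - apply continuity_2d_pt_plus; [apply hg|apply continuity_2d_pt_const]. }
  (* The gap between [dbeta] and [f] along [beta] has a positive minimum on the compact interval;
     half of it keeps the inequality strict. *)
  assert (hmargin : exists e0, 0 < e0 /\
    forall t, Icc t0 (t0 + a) t -> f t (beta t) + e0 < dbeta t).
  { pose (c := clamp t0 (t0 + a)).
    destruct (continuity_ab_min (fun t => dbeta (c t) - g t (beta (c t))) t0 (t0 + a) hi)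
      as [m [hm hmI]].
    - intros t _. apply continuity_pt_minus; [apply continuous_on_clamp; assumption|].
      apply (continuity_pt_graph g (fun x => beta (c x))); [apply hg|].
      apply continuous_on_clamp; assumption.
    - assert (hval : forall t, Icc t0 (t0 + a) t ->
        dbeta (c t) - g t (beta (c t)) = dbeta t - f t (beta t)).
      { intros t ht. unfold c. rewrite clamp_id by exact ht. rewrite hin; auto.
        specialize (hab t ht). lra. }
      exists ((dbeta m - f m (beta m)) / 2).
      assert (hm0 := hltb m hmI). split; [lra|]. intros t ht. specialize (hm t ht).
      cbv beta in hm. rewrite !hval in hm by assumption. lra. }
  destruct hmargin as [e0 [he0 hmargin]].
  (* The perturbed envelopes stay between [alpha] and [beta], so [g] equals [f] along them: [phi 0]
     solves the original problem, and [phi e] with [e > 0] is a strict upper solution. *)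
  assert (hbetw : forall e t, 0 <= e <= e0 -> Icc t0 (t0 + a) t ->
    alpha t <= phi e t <= beta t).
  { intros e t he ht. unfold Icc in ht.
    destruct (Rle_lt_or_eq_dec _ _ (proj1 ht)) as [h|<-]; [|rewrite hphi0; lra].
    split; apply Rlt_le.
    - apply (strict_comparison t0 (t0 + a) (phi e) alpha (fun x => g x (phi e x) + e) dalpha);
        auto; [rewrite hphi0; lra| |lra].
      intros x hx ->. specialize (hab x hx). rewrite hin by (auto; lra).
      specialize (hlta x hx). lra.
    - apply (strict_comparison t0 (t0 + a) beta (phi e) dbeta (fun x => g x (phi e x) + e));
        auto; [rewrite hphi0; lra| |lra].
      intros x hx <-. specialize (hab x hx). rewrite hin by (auto; lra).
      specialize (hmargin x hx). lra. }
  exists (phi 0). split; [split|].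
  - split; [apply hphi0|]. intros t ht.
    apply D_in_ext_on with (phi 0) (fun x => g x (phi 0 x) + 0); auto.
    rewrite hin; [ring|exact ht|apply hbetw; [lra|exact ht]].
  (* Any solution lies in the strip, hence also solves the truncated equation and lies below every
     polygon. *)
  - intros psi hpsi t ht. assert (hpb := hbetween psi hl hu hpsi). destruct hpsi as [hpsi0 hpsi].
    apply (envelope_ge _ t0 y0 (M + Rabs 0) (hMe 0)); [apply ht|]. intros y hy.
    apply (reach_above_subsolution (fun t y => g t y + 0) t0 y0 (t0 + a) psi
             (fun x => f x (psi x))); auto; [|lra|apply ht].
    intros x hx. rewrite hin by auto. lra.
  - intros t eta ht heta.
    destruct (envelope_perturb (fun t y => g t y + 0) t0 y0 (M + Rabs 0) t eta (hMe 0)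
                (proj1 ht) heta) as [e1 [he1 H]].
    (* [e0] keeps [phi e] in the strip, and [e1] keeps it within [eta] of [phi 0] at [t]. *)
    pose (e := Rmin e0 e1).
    assert (he : 0 < e <= e0 /\ e <= e1).
    { split; [split; [apply Rmin_pos; assumption|apply Rmin_l]|apply Rmin_r]. }
    exists (phi e). split.
    + exists (fun x => g x (phi e x) + e). split; [split|split].
      * intros x hx. apply hphi, hx.
      * apply continuous_on_ext with (fun x => g x (phi e (clamp t0 (t0 + a) x)) + e).
        { intros x hx. rewrite clamp_id by exact hx. reflexivity. }
        apply continuity_pt_continuous_on. intros x _.
        apply continuity_pt_plus; [|apply continuity_pt_const; intros ? ?; reflexivity].
        apply (continuity_pt_graph g (fun x => phi e (clamp t0 (t0 + a) x))); [apply hg|].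
        apply continuous_on_clamp; [exact hi|].
        apply D_in_continuous_on with (fun x => g x (phi e x) + e), hphi.
      * rewrite hphi0. lra.
      * intros x hx. rewrite hin by first [exact hx | apply hbetw; [lra|exact hx]]. lra.
    + assert (He := H e ltac:(lra)).
      replace (phi e) with (envelope (fun t y => g t y + 0 + e) t0 y0); [exact He|].
      unfold phi. f_equal.
      do 2 (apply functional_extensionality; intros ?). ring.
Qed.

(** * Gluing solutions and restarting at a later time *)

(** Away from [m] the radius is shrunk so as not to pass [m]; at [m] the smaller of the two
    one-sided radii works. *)
Lemma D_in_glue (g d : R -> R) (p m q : R) :
  p <= m <= q ->
  (forall t, Icc p m t -> D_in g d (Icc p m) t) ->
  (forall t, Icc m q t -> D_in g d (Icc m q) t) ->
  forall t, Icc p q t -> D_in g d (Icc p q) t.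
Proof.
  intros hm h1 h2 t ht e he. unfold Icc in *.
  destruct (total_order_T t m) as [[hlt| ->]|hgt].
  - destruct (h1 t ltac:(lra) e he) as [r [hr Hr]]. exists (Rmin r (m - t)).
    split; [apply Rmin_pos; lra|]. intros x [[hx hne] hxt]. simpl in *. unfold Rdist in hxt.
    assert (hr1 := Rlt_le_trans _ _ _ hxt (Rmin_l _ _)).
    assert (hr2 := Rlt_le_trans _ _ _ hxt (Rmin_r _ _)). apply Rabs_lt_between in hr2.
    apply Hr. split; [split; [lra|exact hne]|exact hr1].
  - destruct (h1 m ltac:(lra) e he) as [r [hr Hr]].
    destruct (h2 m ltac:(lra) e he) as [r' [hr' Hr']]. exists (Rmin r r').
    split; [apply Rmin_pos; lra|]. intros x [[hx hne] hxt]. simpl in *.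
    destruct (Rle_or_lt x m).
    + apply Hr. split; [split; [lra|exact hne]|exact (Rlt_le_trans _ _ _ hxt (Rmin_l _ _))].
    + apply Hr'. split; [split; [lra|exact hne]|exact (Rlt_le_trans _ _ _ hxt (Rmin_r _ _))].
  - destruct (h2 t ltac:(lra) e he) as [r [hr Hr]]. exists (Rmin r (t - m)).
    split; [apply Rmin_pos; lra|]. intros x [[hx hne] hxt]. simpl in *. unfold Rdist in hxt.
    assert (hr1 := Rlt_le_trans _ _ _ hxt (Rmin_l _ _)).
    assert (hr2 := Rlt_le_trans _ _ _ hxt (Rmin_r _ _)). apply Rabs_lt_between in hr2.
    apply Hr. split; [split; [lra|exact hne]|exact hr1].
Qed.

Lemma solution_glue (t0 y0 t1 b a : R) (f : R -> R -> R) (phi chi : R -> R) :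
  0 < b -> 0 < a -> t1 = t0 + b ->
  solution t0 y0 b f phi -> solution t1 (phi t1) a f chi ->
  exists psi, solution t0 y0 (b + a) f psi /\
    forall t, Icc t0 t1 t -> psi t = phi t.
Proof.
  intros hb ha ht1 [hphi0 hphi] [hchi0 hchi]. rewrite <- ht1 in hphi.
  pose (psi t := if Rle_dec t t1 then phi t else chi t).
  assert (h1 : forall t, Icc t0 t1 t -> phi t = psi t).
  { intros t [_ ht]. unfold psi. destruct Rle_dec; [reflexivity|lra]. }
  assert (h2 : forall t, Icc t1 (t1 + a) t -> chi t = psi t).
  { intros t [ht _]. unfold psi. destruct Rle_dec as [hle|hle]; [|reflexivity].
    replace t with t1 by lra. exact hchi0. }
  exists psi. split; [split|].
  - rewrite <- h1; [exact hphi0|unfold Icc; lra].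
  - replace (t0 + (b + a)) with (t1 + a) by lra.
    apply D_in_glue with t1; [lra| |].
    + intros t ht. apply D_in_ext_on with phi (fun s => f s (phi s)); auto.
      rewrite h1; auto.
    + intros t ht. apply D_in_ext_on with chi (fun s => f s (chi s)); auto.
      rewrite h2; auto.
  - intros t ht. symmetry. apply h1, ht.
Qed.

Lemma strict_lower_restrict (t0 y0 a t1 y1 a1 : R) (f : R -> R -> R) (alpha : R -> R) :
  strict_lower_solution t0 y0 a f alpha -> t0 <= t1 -> t1 + a1 = t0 + a ->
  alpha t1 <= y1 -> strict_lower_solution t1 y1 a1 f alpha.
Proof.
  intros [d [[hD hC] [_ hlt]]] ht1 heq hy1.
  assert (hsub : forall t, Icc t1 (t1 + a1) t -> Icc t0 (t0 + a) t) by (unfold Icc; intros; lra).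
  exists d. split; [split|split]; auto.
  - intros t ht. apply D_in_imp with (Icc t0 (t0 + a)); auto.
  - apply continuous_on_subset with (2 := hC). exact hsub.
Qed.

Lemma strict_upper_restrict (t0 y0 a t1 y1 a1 : R) (f : R -> R -> R) (beta : R -> R) :
  strict_upper_solution t0 y0 a f beta -> t0 <= t1 -> t1 + a1 = t0 + a ->
  beta t1 >= y1 -> strict_upper_solution t1 y1 a1 f beta.
Proof.
  intros [d [[hD hC] [_ hlt]]] ht1 heq hy1.
  assert (hsub : forall t, Icc t1 (t1 + a1) t -> Icc t0 (t0 + a) t) by (unfold Icc; intros; lra).
  exists d. split; [split|split]; auto.
  - intros t ht. apply D_in_imp with (Icc t0 (t0 + a)); auto.
  - apply continuous_on_subset with (2 := hC). exact hsub.
Qed.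

(** * Reflection in the [y] variable *)

(** The field solved by [-y] when [y] solves [y' = f (t, y)]; strict lower and upper solutions trade
    places. *)
Definition reflect (f : R -> R -> R) (t y : R) : R := - f t (- y).

Lemma reflect_continuous_on (J : R -> Prop) (f : R -> R -> R) :
  continuous_on (fun p : R * R => J (fst p)) (fun p : R * R => f (fst p) (snd p)) ->
  continuous_on (fun p : R * R => J (fst p)) (fun p : R * R => reflect f (fst p) (snd p)).
Proof.
  intros hf [t y] ht. apply filterlim_locally. intros e.
  destruct (proj1 (filterlim_locally _ _) (hf (t, - y) ht) e) as [d Hd].
  exists d. intros [t' y'] [hx hy] hJ.
  specialize (Hd (t', - y')). change (Rabs (y' - y) < d) in hy.
  assert (H : Rabs (f t' (- y') - f t (- y)) < e).
  { apply Hd; [split; [exact hx|]|exact hJ].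
    change (Rabs (- y' - - y) < d). rewrite Rabs_minus_sym.
    replace (- y - - y') with (y' - y) by ring. exact hy. }
  change (Rabs (- f t' (- y') - - f t (- y)) < e). rewrite Rabs_minus_sym.
  replace (- f t (- y) - - f t' (- y')) with (f t' (- y') - f t (- y)) by ring. exact H.
Qed.

Lemma is_C1_deriv_on_opp (J : R -> Prop) (g d : R -> R) :
  is_C1_deriv_on J g d -> is_C1_deriv_on J (fun t => - g t) (fun t => - d t).
Proof.
  intros [hD hC]. split.
  - intros t ht. apply Dopp, hD, ht.
  - intros t ht. apply filterlim_comp with (1 := hC t ht). apply (filterlim_opp (d t)).
Qed.

Lemma strict_lower_reflect (t0 y0 a : R) (f : R -> R -> R) (gamma : R -> R) :
  strict_lower_solution t0 y0 a f gamma ->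
  strict_upper_solution t0 (- y0) a (reflect f) (fun t => - gamma t).
Proof.
  intros [d [hd [h0 hlt]]]. exists (fun t => - d t). split; [|split].
  - apply is_C1_deriv_on_opp, hd.
  - lra.
  - intros t ht. unfold reflect. rewrite Ropp_involutive. specialize (hlt t ht). lra.
Qed.

Lemma strict_upper_reflect (t0 y0 a : R) (f : R -> R -> R) (gamma : R -> R) :
  strict_upper_solution t0 y0 a f gamma ->
  strict_lower_solution t0 (- y0) a (reflect f) (fun t => - gamma t).
Proof.
  intros [d [hd [h0 hlt]]]. exists (fun t => - d t). split; [|split].
  - apply is_C1_deriv_on_opp, hd.
  - lra.
  - intros t ht. unfold reflect. rewrite Ropp_involutive. specialize (hlt t ht). lra.
Qed.

Lemma strict_upper_unreflect (t0 y0 a : R) (f : R -> R -> R) (gamma : R -> R) :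
  strict_upper_solution t0 (- y0) a (reflect f) gamma ->
  strict_lower_solution t0 y0 a f (fun t => - gamma t).
Proof.
  intros [d [hd [h0 hlt]]]. exists (fun t => - d t). split; [|split].
  - apply is_C1_deriv_on_opp, hd.
  - lra.
  - intros t ht. unfold reflect in hlt. specialize (hlt t ht). lra.
Qed.

Lemma solution_reflect (t0 y0 b : R) (f : R -> R -> R) (phi : R -> R) :
  solution t0 y0 b f phi -> solution t0 (- y0) b (reflect f) (fun t => - phi t).
Proof.
  intros [h0 hD]. split; [now rewrite h0|]. intros t ht.
  apply D_in_ext_on with (fun t => - phi t) (fun t => - f t (phi t)); auto.
  - unfold reflect. now rewrite Ropp_involutive.
  - apply Dopp, hD, ht.
Qed.

Lemma solution_unreflect (t0 y0 b : R) (f : R -> R -> R) (phi : R -> R) :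
  solution t0 (- y0) b (reflect f) phi -> solution t0 y0 b f (fun t => - phi t).
Proof.
  intros [h0 hD]. split; [rewrite h0; ring|]. intros t ht.
  apply D_in_ext_on with (fun t => - phi t) (fun t => - reflect f t (phi t)); auto.
  - unfold reflect. ring.
  - apply Dopp, hD, ht.
Qed.

(** * The least solution and its approximation from below *)

Lemma least_solution_exists (t0 y0 a : R) (f : R -> R -> R) (alpha beta : R -> R) :
  0 < a ->
  continuous_on (fun p : R * R => Icc t0 (t0 + a) (fst p))
    (fun p : R * R => f (fst p) (snd p)) ->
  strict_lower_solution t0 y0 a f alpha ->
  strict_upper_solution t0 y0 a f beta ->
  exists phi, least_solution t0 y0 a f phi /\
    forall t eta, Icc t0 (t0 + a) t -> 0 < eta ->
      exists gamma, strict_lower_solution t0 y0 a f gamma /\ phi t - eta < gamma t.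
Proof.
  intros ha hf hl hu.
  destruct (greatest_solution_exists t0 (- y0) a (reflect f) (fun t => - beta t)
              (fun t => - alpha t) ha (reflect_continuous_on _ _ hf)
              (strict_upper_reflect _ _ _ _ _ hu) (strict_lower_reflect _ _ _ _ _ hl))
    as [phi [[hphi hmax] happrox]].
  exists (fun t => - phi t). split; [split|].
  - apply solution_unreflect, hphi.
  - intros psi hpsi t ht. assert (H := hmax _ (solution_reflect _ _ _ _ _ hpsi) t ht).
    cbv beta in H. lra.
  - intros t eta ht heta. destruct (happrox t eta ht heta) as [gamma [hg hlt]].
    exists (fun t => - gamma t). split; [apply strict_upper_unreflect, hg|lra].
Qed.

(** * Infima and suprema from approximating elements *)

Lemma Glb_Rbar_approx (E : R -> Prop) (l : R) :
  (forall y, E y -> l <= y) ->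
  (forall eta, 0 < eta -> exists y, E y /\ y < l + eta) ->
  Finite l = Glb_Rbar E.
Proof.
  intros hlb happrox. symmetry. apply is_glb_Rbar_unique. split.
  - intros y hy. apply hlb, hy.
  - intros b hb. destruct b as [b| |]; simpl.
    + apply le_epsilon. intros eta heta. destruct (happrox eta heta) as [y [hy hlt]].
      assert (H := hb y hy). simpl in H. lra.
    (* The value 1 only serves to produce an element of [E], which refutes an infinite lower
       bound. *)
    + destruct (happrox 1 Rlt_0_1) as [y [hy _]]. apply (hb y hy).
    + exact I.
Qed.

Lemma Lub_Rbar_approx (E : R -> Prop) (l : R) :
  (forall y, E y -> y <= l) ->
  (forall eta, 0 < eta -> exists y, E y /\ l - eta < y) ->
  Finite l = Lub_Rbar E.
Proof.
  intros hub happrox. symmetry. apply is_lub_Rbar_unique. split.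
  - intros y hy. apply hub, hy.
  - intros b hb. destruct b as [b| |]; simpl.
    + apply le_epsilon. intros eta heta. destruct (happrox eta heta) as [y [hy hlt]].
      assert (H := hb y hy). simpl in H. lra.
    + exact I.
    + destruct (happrox 1 Rlt_0_1) as [y [hy _]]. apply (hb y hy).
Qed.

(** * Existence, extension and extremal solutions *)

Theorem theorem4p4 (t0 y0 a : R) (f : R -> R -> R) (alpha beta : R -> R)
  (ha : 0 < a)
  (hf : continuous_on (fun p : R * R => Icc t0 (t0 + a) (fst p))
          (fun p : R * R => f (fst p) (snd p)))
  (halpha : strict_lower_solution t0 y0 a f alpha)
  (hbeta : strict_upper_solution t0 y0 a f beta) :
  (exists phi : R -> R, solution t0 y0 a f phi)
  /\
  (forall (eps : R) (phi : R -> R),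
     0 < eps < a -> solution t0 y0 eps f phi ->
     (exists psi : R -> R,
        solution t0 y0 a f psi /\
        (forall t, Icc t0 (t0 + eps) t -> psi t = phi t)) /\
     (forall psi : R -> R,
        solution t0 y0 a f psi ->
        (forall t, Icc t0 (t0 + eps) t -> psi t = phi t) ->
        forall t, t0 < t <= t0 + a -> alpha t < psi t < beta t))
  /\
  (exists phi_min phi_max : R -> R,
     least_solution t0 y0 a f phi_min /\
     greatest_solution t0 y0 a f phi_max /\
     (forall t, Icc t0 (t0 + a) t ->
        Finite (phi_min t) =
          Lub_Rbar (fun y => exists gamma : R -> R,
                      strict_lower_solution t0 y0 a f gamma /\ y = gamma t)) /\
     (forall t, Icc t0 (t0 + a) t ->
        Finite (phi_max t) =
          Glb_Rbar (fun y => exists gamma : R -> R,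
                      strict_upper_solution t0 y0 a f gamma /\ y = gamma t))).
Proof.
  destruct (greatest_solution_exists t0 y0 a f alpha beta ha hf halpha hbeta)
    as [phi_max [hmax hmaxapprox]].
  destruct (least_solution_exists t0 y0 a f alpha beta ha hf halpha hbeta)
    as [phi_min [hmin hminapprox]].
  split; [exists phi_max; apply hmax|split].
  - intros eps phi heps hphi. split.
    + pose (t1 := t0 + eps).
      assert (h1 := strict_lower_lt_solution _ _ _ _ _ _ _ halpha (Rlt_le _ _ (proj2 heps))
                      hphi t1 ltac:(unfold t1; lra)).
      assert (h2 := solution_lt_strict_upper _ _ _ _ _ _ _ hbeta (Rlt_le _ _ (proj2 heps))
                      hphi t1 ltac:(unfold t1; lra)).
      assert (hend : t1 + (a - eps) = t0 + a) by (unfold t1; ring).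
      (* As [phi t1] lies between [alpha t1] and [beta t1], both remain strict lower and upper
         solutions of the problem restarted at [(t1, phi t1)]; one of its solutions is then glued to
         [phi]. *)
      destruct (greatest_solution_exists t1 (phi t1) (a - eps) f alpha beta)
        as [chi [[hchi _] _]].
      * lra.
      * apply continuous_on_subset with (2 := hf). intros p. unfold Icc, t1. lra.
      * apply strict_lower_restrict with t0 y0 a; try assumption; unfold t1 in *; lra.
      * apply strict_upper_restrict with t0 y0 a; try assumption; unfold t1 in *; lra.
      * destruct (solution_glue t0 y0 t1 eps (a - eps) f phi chi) as [psi [hpsi hext]];
          try assumption; unfold t1 in *; try lra.
        exists psi. split; [|exact hext].
        replace a with (eps + (a - eps)) by ring. exact hpsi.
    + intros psi hpsi _ t ht. split.
      * apply (strict_lower_lt_solution _ _ _ _ _ _ _ halpha (Rle_refl a) hpsi t ht).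
      * apply (solution_lt_strict_upper _ _ _ _ _ _ _ hbeta (Rle_refl a) hpsi t ht).
  - exists phi_min, phi_max. split; [exact hmin|]. split; [exact hmax|]. split.
    + intros t ht. apply Lub_Rbar_approx.
      (* Every strict lower solution can replace [alpha] in the comparison, so it lies below
         [phi_min]. *)
      * intros y [gamma [hg ->]].
        apply (solution_between _ _ _ _ _ _ _ hg hbeta (proj1 hmin) t ht).
      * intros eta heta. destruct (hminapprox t eta ht heta) as [gamma [hg hlt]]. eauto.
    + intros t ht. apply Glb_Rbar_approx.
      * intros y [gamma [hg ->]].
        apply (solution_between _ _ _ _ _ _ _ halpha hg (proj1 hmax) t ht).
      * intros eta heta. destruct (hmaxapprox t eta ht heta) as [gamma [hg hlt]]. eauto.
Qed.
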